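(* Let $\mathcal{U}$ be a right (or left) Lebesgue-ultrafilter on $\mathbb{R}$. Then the functional $\mathcal{B}\lim_{\mathcal{U}}:L^\infty(\mathbb{R})\to\mathbb{R}$, $\mathcal{B}\lim_{\mathcal{U}}u:=\lim_{\mathcal{U}}\widehat{u}$, is a non-trivial, monotone, continuous, translation-invariant valuation.
   Context: $L^\infty(\mathbb{R})$ is the usual space of essentially bounded Lebesgue measurable functions $\mathbb{R}\to\mathbb{R}$ modulo almost everywhere equality, with the essential supremum norm $\|\cdot\|_\infty$. $B_\varepsilon(l)$ is the open interval $(l-\varepsilon,l+\varepsilon)$, and $A^\complement:=\mathbb{R}\setminus A$. A filter on $\mathbb{R}$ is a family $\mathcal{F}$ of subsets of $\mathbb{R}$ with $\mathbb{R}\in\mathcal{F}$, $\emptyset\notin\mathcal{F}$, closed under finite intersections and under supersets in $\mathbb{R}$. An ultrafilter is a filter $\mathcal{U}$ such that for all $A\subseteq\mathbb{R}$ either $A\in\mathcal{U}$ or $A^\complement\in\mathcal{U}$. An ultrafilter $\mathcal{U}$ is a Lebesgue-ultrafilter if $N^\complement\in\mathcal{U}$ for every Lebesgue-null set $N\subseteq\mathbb{R}$; it is a right (respectively, left) ultrafilter if $(a,\infty)\in\mathcal{U}$ (respectively, $(-\infty,a)\in\mathcal{U}$) for all $a\in\mathbb{R}$. For a Lebesgue-ultrafilter $\mathcal{U}$ and $v\in L^\infty(\mathbb{R})$, $\lim_{\mathcal{U}}v$ is the (unique, representative-independent) real number $l$ such that $\{x\in\mathbb{R}: v(x)\in B_\varepsilon(l)\}\in\mathcal{U}$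 for all $\varepsilon>0$. The Cesàro-like average of a bounded measurable $u:\mathbb{R}\to\mathbb{R}$ is $\widehat{u}(0):=u(0)$ and $\widehat{u}(x):=\frac1x\int_0^x u(y)\,dy$ for $x\neq0$ (with $\int_a^b:=-\int_{[b,a]}$ if $b<a$); it induces an operator $\widehat{\cdot}:L^\infty(\mathbb{R})\to L^\infty(\mathbb{R})$. $u\lor v$, $u\land v$ are the pointwise maximum and minimum, $\mathbf{0}$ is the zero function. A valuation is a map $\mu:L^\infty(\mathbb{R})\to\mathbb{R}$ with $\mu(u\lor v)+\mu(u\land v)=\mu(u)+\mu(v)$ for all $u,v\in L^\infty(\mathbb{R})$ and $\mu(\mathbf{0})=0$. It is translation-invariant if $\mu(\mathcal{T}_tu)=\mu(u)$ for all $u\in L^\infty(\mathbb{R})$, $t\in\mathbb{R}$, where $\mathcal{T}_tu(x):=u(x-t)$; monotone if $u\le v$ almost everywhere implies $\mu(u)\le\mu(v)$; continuous if $\|u_n-u\|_\infty\to0$ implies $\mu(u_n)\to\mu(u)$; non-trivial if it does not assign the value $0$ to every function. *)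

(* Defs.v *)
From HB Require Import structures.
From mathcomp Require Import all_boot all_order all_algebra.
From mathcomp Require Import all_classical all_reals all_analysis.
From mathcomp Require Import measurable_realfun ess_sup_inf hoelder.

Set Implicit Arguments.
Unset Strict Implicit.
Unset Printing Implicit Defensive.
Import Order.TTheory GRing.Theory Num.Theory.
Import numFieldNormedType.Exports.

Local Open Scope classical_set_scope.
Local Open Scope ring_scope.

(* Lebesgue measurability is Caratheodory measurability: the underlying measure
   is the completed Lebesgue measure, not the one on the Borel sigma-algebra. *)
Notation leb R := (@completed_lebesgue_measure R).
Notation lebT R := (caratheodory_type (mu_ext (@wlength R idfun))).

#[global] Instance leb_ae_filter (R : realType) :
  Filter (almost_everywhere (leb R)) := ae_filter_ringOfSetsType (leb R).
#[global] Instance leb_nbhs_ae_filter (R : realType) :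
  Filter (nbhs (almost_everywhere (leb R))) := ae_filter_ringOfSetsType (leb R).

Section Linfty.
Context {R : realType}.
Local Notation leb := (leb R).
Implicit Types (f g : R -> R).

Definition Linfty := LspaceType leb (leey 1%:E).

(* A chosen representative of the almost-everywhere class [u]. *)
Definition linf_fun (u : Linfty) : R -> R := u.

Lemma LfunyP f : f \in Lfun leb +oo%E <->
  measurable_fun [set: lebT R] f /\
  exists M : R, \forall x \ae leb, `|f x| <= M.
Proof.
have E : finite_norm leb +oo%E f <->
    exists M : R, \forall x \ae leb, `|f x| <= M.
  rewrite /finite_norm unlock /=; split.
    case: ifPn => [_|]; last first.
      rewrite -leNgt measure_le0 => /eqP mu0 _; exists 0; exact: measure0_ae.
    have lef r : (ess_sup leb (abse \o (EFin \o f)) <= r%:E)%E ->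
        \forall x \ae leb, `|f x| <= r.
      by move=> /ess_supP; apply: filterS => x /=; rewrite lee_fin.
    move: lef; case: (ess_sup _ _) => [r|//|] lef _.
      by exists r; exact: lef.
    by exists 0; apply: lef; rewrite leNye.
  move=> [M fM]; case: ifPn => // _.
  apply: (@le_lt_trans _ _ M%:E); last exact: ltry.
  by apply/ess_supP; apply: filterS fM => x /=; rewrite lee_fin.
rewrite -E; split.
  by move=> /andP[mf ff]; split; [move/set_mem: mf|move/set_mem: ff].
by move=> [mf ff]; apply/andP; split; exact/mem_set.
Qed.

Lemma linf_funP (u : Linfty) : linf_fun u \in Lfun leb +oo%E.
Proof.
apply/andP; split; apply/mem_set.
  exact: (@measurable_funPT _ _ _ _ (repr (u : {mfun_ leb, _ >-> _}))).
exact: (@Lebesgue_finite _ _ _ _ _ _ u).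
Qed.

Fact linf_measurable f (fP : f \in Lfun leb +oo%E) :
  measurable_fun [set: lebT R] (f : lebT R -> measurableTypeR R).
Proof. by have [] := (LfunyP f).1 fP. Qed.

Definition linf_rep f (fP : f \in Lfun leb +oo%E) :
    {mfun lebT R >-> measurableTypeR R} :=
  mfun_Sub (mem_set (linf_measurable fP)).

Definition linf_mfun f (fP : f \in Lfun leb +oo%E) :
    {mfun_ leb, lebT R >-> measurableTypeR R} :=
  (\pi_({mfun_ leb, lebT R >-> measurableTypeR R}) (linf_rep fP))%qT.

Lemma linf_mfunE f (fP : f \in Lfun leb +oo%E) :
  \forall x \ae leb, (linf_mfun fP : R -> R) x = f x.
Proof.
have /asboolP : ae_eq_op leb (repr (linf_mfun fP)) (linf_rep fP).
  by rewrite -eqmodE reprK.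
by apply: filterS => x /(_ I).
Qed.

Fact linf_mfun_finite f (fP : f \in Lfun leb +oo%E) :
  finite_norm leb +oo%E (linf_mfun fP).
Proof.
have [mf [M fM]] := (LfunyP f).1 fP.
suff /andP[_ /set_mem//] : (linf_mfun fP : R -> R) \in Lfun leb +oo%E.
apply/LfunyP; split; first exact: (@measurable_funPT _ _ _ _ (repr (linf_mfun fP))).
by exists M; apply: filterS2 fM (linf_mfunE fP) => x fM ->.
Qed.

HB.instance Definition _ f (fP : f \in Lfun leb +oo%E) :=
  isFinLebesgue.Build _ _ R leb +oo%E (leey 1%:E) (linf_mfun fP)
    (linf_mfun_finite fP).

(* The class of an essentially bounded measurable function. *)
Definition linf_class f (fP : f \in Lfun leb +oo%E) : Linfty :=
  [the LspaceType leb (leey 1%:E) of linf_mfun fP].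

Lemma linf_classE f (fP : f \in Lfun leb +oo%E) :
  \forall x \ae leb, linf_fun (linf_class fP) x = f x.
Proof. exact: linf_mfunE. Qed.

Lemma linf_eqP (u v : Linfty) :
  u = v <-> \forall x \ae leb, linf_fun u x = linf_fun v x.
Proof.
split=> [->|uv]; first exact: aeW.
have : u = v :> {mfun_ leb, lebT R >-> measurableTypeR R}.
  rewrite -[LHS]reprK -[RHS]reprK; apply/eqmodP/asboolP.
  by apply: filterS uv => x + _.
case: u v {uv} => [u [[uP]]] [v [[vP]]] /= uv.
by subst v; rewrite (Prop_irrelevance uP vP).
Qed.
Fact linf_max_Lfun (u v : Linfty) :
  (fun x => Num.max (linf_fun u x) (linf_fun v x)) \in Lfun leb +oo%E.
Proof.
have [mu [M uM]] := (LfunyP _).1 (linf_funP u).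
have [mv [N vN]] := (LfunyP _).1 (linf_funP v).
apply/LfunyP; split; first exact: measurable_maxr.
exists (Num.max M N); apply: filterS2 uM vN => x uM vN.
rewrite le_max; case: (leP (linf_fun u x) (linf_fun v x)) => _.
  by rewrite vN orbT.
by rewrite uM.
Qed.

Fact linf_min_Lfun (u v : Linfty) :
  (fun x => Num.min (linf_fun u x) (linf_fun v x)) \in Lfun leb +oo%E.
Proof.
have [mu [M uM]] := (LfunyP _).1 (linf_funP u).
have [mv [N vN]] := (LfunyP _).1 (linf_funP v).
apply/LfunyP; split; first exact: measurable_minr.
exists (Num.max M N); apply: filterS2 uM vN => x uM vN.
rewrite le_max; case: (leP (linf_fun u x) (linf_fun v x)) => _.
  by rewrite uM.
by rewrite vN orbT.
Qed.

Fact linf_cst_Lfun (c : R) : cst c \in Lfun leb +oo%E.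
Proof.
apply/LfunyP; split; first exact: measurable_cst.
by exists `|c|; exact: aeW.
Qed.

Lemma mu_ext_shift_le (t : R) (A : set R) :
  (mu_ext (@wlength R idfun) [set x | A (x - t)%R] <=
   mu_ext (@wlength R idfun) A)%E.
Proof.
apply/le_ereal_inf_tmp => _ [F [mF AF] <-].
apply: ereal_inf_lbound; exists (fun k => [set x | F k (x - t)]).
  split=> [k|x /AF [k _ Fk]]; last by exists k.
  have [[a b] _ /= <-] := mF k; exists (a + t, b + t) => //=.
  by apply/seteqP; split=> x /=; rewrite !in_itv/= ltrBrDr lerBlDr.
apply: eq_eseriesr => k _.
have [[a b] _ /= <-] := mF k.
rewrite [X in wlength _ X](_ : _ = `]a + t, b + t]%classic).
  by rewrite !wlength_itv/= !lte_fin ltrD2r -!EFinB/=; case: ifP => // _;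
    rewrite opprD addrACA subrr addr0.
by apply/seteqP; split=> x /=; rewrite !in_itv/= ltrBrDr lerBlDr.
Qed.

Lemma mu_ext_shift (t : R) (A : set R) :
  mu_ext (@wlength R idfun) [set x | A (x - t)] = mu_ext (@wlength R idfun) A.
Proof.
apply/eqP; rewrite eq_le mu_ext_shift_le/=.
have := mu_ext_shift_le (- t) [set x | A (x - t)].
by under [X in mu_ext _ X]eq_set do rewrite /= opprK addrK.
Qed.

Lemma leb_measurable_shift (t : R) (A : set (lebT R)) :
  measurable A -> measurable ([set x | A (x - t)] : set (lebT R)).
Proof.
move=> mA.
have cA : caratheodory_measurable (mu_ext (@wlength R idfun)) A by [].
suff : caratheodory_measurable (mu_ext (@wlength R idfun)) [set x | A (x - t)].
  by [].
move=> X; have := cA [set x | X (x + t)].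
have E (B : set R) : mu_ext (@wlength R idfun) [set x | B (x + t)] =
    mu_ext (@wlength R idfun) B.
  by rewrite -[in LHS](opprK t) mu_ext_shift.
rewrite E => ->; rewrite -(E (X `&` [set x | A (x - t)])).
rewrite -(E (X `&` ~` [set x | A (x - t)])); congr (_ + _)%E;
  congr mu_ext; apply/seteqP; split=> x /=; by rewrite addrK.
Qed.

Lemma ae_shift (t : R) (P : R -> Prop) :
  (\forall x \ae leb, P x) -> \forall x \ae leb, P (x - t).
Proof.
move=> [N [mN N0 PN]]; exists [set x | N (x - t)]; split.
- exact: leb_measurable_shift.
- by rewrite -N0; exact: mu_ext_shift.
- by move=> x /= nP; exact: PN.
Qed.

Fact linf_translate_Lfun (t : R) (u : Linfty) :
  (fun x => linf_fun u (x - t)) \in Lfun leb +oo%E.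
Proof.
have [mu [M uM]] := (LfunyP _).1 (linf_funP u).
apply/LfunyP; split; last by exists M; exact: (@ae_shift t _ uM).
move=> _ Y mY; rewrite setTI; have := mu measurableT Y mY; rewrite setTI.
exact: leb_measurable_shift.
Qed.

Lemma leb_itv (i : interval R) :
  leb [set` i] = (if i.1 < i.2 then (i.2 : \bar R) - i.1 else 0)%E.
Proof. exact: lebesgue_measure_itv. Qed.

Lemma leb_measurable_itv (i : interval R) :
  measurable ([set` i] : set (lebT R)).
Proof. apply: (@sub_caratheodory _ _ _ (@wlength R idfun)); exact: (@measurable_itv R i). Qed.

Lemma leb_measurable_borel f : measurable_fun [set: R] f ->
  measurable_fun [set: lebT R] f.
Proof.
move=> mf _ Y mY; have := mf measurableT Y mY.
exact: (@sub_caratheodory _ _ _ (@wlength R idfun)).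
Qed.

Definition oint f (a b : R) : R :=
  if a <= b then \int[leb]_(y in `[a, b]) f y
  else - \int[leb]_(y in `[b, a]) f y.

(* [oint] is oriented: the integral changes sign when b < a. *)
Definition cesaro f (x : R) : R :=
  if x == 0 then f 0 else x^-1 * oint f 0 x.

Section cesaro_facts.
Variables (f : R -> R) (M : R).
Hypothesis mf : measurable_fun [set: lebT R] f.
Hypothesis M0 : 0 <= M.
Hypothesis fM : \forall x \ae leb, `|f x| <= M.

Let fM_on (D : set R) :
  {ae leb, forall x, D x -> (`|(EFin \o f) x| <= M%:E)%E}.
Proof. by apply: filterS fM => x /=; rewrite lee_fin. Qed.

Let mfD (D : set (lebT R)) : measurable_fun D (EFin \o f).
Proof. exact/measurable_EFinP/(measurable_funS _ _ mf). Qed.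

Lemma bounded_integrable_itv (a b : R) (x y : bool) :
  leb.-integrable [set` Interval (BSide x a) (BSide y b)] (EFin \o f).
Proof.
apply/integrableP; split; first exact: mfD.
apply: le_lt_trans.
  apply: (@integral_le_bound _ _ _ leb _ _ M%:E).
  - exact: leb_measurable_itv.
  - exact: mfD.
  - by rewrite lee_fin.
  - exact: fM_on.
rewrite [X in (_ * X)%E](leb_itv (Interval (BSide x a) (BSide y b)))/=.
case: ifP => _; last by rewrite mule0 ltry.
by rewrite -EFinB -EFinM ltry.
Qed.

Lemma bounded_Rintegral_itv (a b : R) (x y : bool) : a <= b ->
  `|\int[leb]_(t in [set` Interval (BSide x a) (BSide y b)]) f t| <= M * (b - a).
Proof.
move=> ab; have fi := bounded_integrable_itv a b x y.
have mi := leb_measurable_itv (Interval (BSide x a) (BSide y b)).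
apply: le_trans (le_normr_Rintegral mi fi) _.
have := @integral_le_bound _ _ _ leb _ _ M%:E mi (@mfD _) _ (@fM_on _).
rewrite lee_fin M0 => /(_ isT) le.
rewrite -lee_fin /Rintegral fineK; last first.
  by apply: integrable_fin_num => //; exact: integrable_abse fi.
apply: le_trans le _; rewrite [X in (_ * X)%E](leb_itv (Interval (BSide x a) (BSide y b)))/=.
case: ifP => _.
  by rewrite -EFinB -EFinM.
by rewrite mule0 lee_fin mulr_ge0// subr_ge0.
Qed.

Lemma oint_lipschitz (x y : R) : x <= y ->
  `|oint f 0 y - oint f 0 x| <= M * (y - x).
Proof.
move=> xy; rewrite /oint; have [x0|x0] := leP 0 x.
  rewrite (le_trans x0 xy).
  rewrite (@itv_bndbnd_setU _ _ _ (BRight x) (BRight y)) ?bnd_simp//.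
  rewrite Rintegral_setU//; last 4 first.
  - exact: leb_measurable_itv.
  - exact: leb_measurable_itv.
  - rewrite -itv_bndbnd_setU ?bnd_simp//; exact: bounded_integrable_itv.
  - apply/disj_setPS => z [/=]; rewrite 2!in_itv/= => /andP[_ zx] /andP[].
    by rewrite ltNge zx.
  by rewrite addrAC subrr add0r bounded_Rintegral_itv.
rewrite opprK; have [y0|y0] := leP 0 y.
  apply: le_trans (ler_normD _ _) _.
  rewrite (_ : y - x = (y - 0) + (0 - x)); last by rewrite subr0 sub0r.
  by rewrite mulrDr lerD// bounded_Rintegral_itv// ltW.
rewrite (@itv_bndbnd_setU _ _ (BLeft x) (BLeft y) (BRight 0)) ?bnd_simp//; last exact: ltW.
rewrite Rintegral_setU//; last 4 first.
- exact: leb_measurable_itv.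
- exact: leb_measurable_itv.
- rewrite -itv_bndbnd_setU ?bnd_simp//; last exact: ltW.
  exact: bounded_integrable_itv.
- apply/disj_setPS => z [/=]; rewrite 2!in_itv/= => /andP[_ zx] /andP[].
  by rewrite leNgt zx.
by rewrite addrCA addNr addr0 bounded_Rintegral_itv.
Qed.

Lemma oint_continuous : continuous (oint f 0).
Proof.
move=> x; apply/cvgrPdist_le => e e0.
have M1 : 0 < M + 1 by rewrite ltr_wpDl.
near=> y.
have : `|x - y| <= e / (M + 1).
  near: y; apply: (@cvgr_dist_le _ _ _ (nbhs x) _ id x) => //.
  by rewrite divr_gt0.
rewrite ler_pdivlMr// => le; apply: le_trans le.
have [xy|/ltW yx] := leP x y.
  rewrite distrC (le_trans (oint_lipschitz xy))//.
  by rewrite (distrC x y) ger0_norm ?subr_ge0// [leRHS]mulrDr mulr1 mulrC lerDl subr_ge0.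
rewrite (le_trans (oint_lipschitz yx))//.
by rewrite ger0_norm ?subr_ge0// [leRHS]mulrDr mulr1 mulrC lerDl subr_ge0.
Unshelve. all: by end_near. Qed.

Lemma cesaro_measurable : measurable_fun [set: lebT R] (cesaro f).
Proof.
apply: leb_measurable_borel; apply: measurable_fun_if => //.
- exact: measurable_fun_eqr.
- apply: open_continuous_measurable_fun.
    rewrite setTI (_ : _ @^-1` _ = ~` [set 0]); last first.
      by apply/seteqP; split=> x /=; [move=> /negbT/eqP|move=> /eqP/negbTE].
    by apply: closed_openC; exact: closed_eq.
  move=> x; rewrite inE setTI/= => /negbT x0.
  by apply: cvgM; [exact: inv_continuous|exact: oint_continuous].
Qed.

Lemma cesaro_bounded (x : R) : `|cesaro f x| <= Num.max M `|f 0|.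
Proof.
rewrite /cesaro le_max; have [x0|x0] := eqVneq x 0; first by rewrite lexx orbT.
apply/orP; left; rewrite normrM normfV ler_pdivrMl ?normr_gt0// mulrC.
rewrite /oint; case: ifPn => [x0'|].
  by rewrite (le_trans (bounded_Rintegral_itv _ _ _))// subr0 ger0_norm.
rewrite -ltNge => x0'; rewrite normrN.
by rewrite (le_trans (bounded_Rintegral_itv _ _ (ltW x0')))// sub0r ltr0_norm.
Qed.
End cesaro_facts.

Fact linf_cesaro_Lfun (u : Linfty) : cesaro (linf_fun u) \in Lfun leb +oo%E.
Proof.
have [mu [M uM]] := (LfunyP _).1 (linf_funP u).
have M0 : 0 <= Num.max 0 M by rewrite le_max lexx.
have uM' : \forall x \ae leb, `|linf_fun u x| <= Num.max 0 M.
  by apply: filterS uM => x uM; rewrite le_max uM orbT.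
apply/LfunyP; split; first exact: cesaro_measurable uM'.
by eexists; apply: aeW => x; exact: (cesaro_bounded mu M0 uM').
Qed.

Definition linf_zero : Linfty := linf_class (linf_cst_Lfun 0).
Definition linf_join (u v : Linfty) : Linfty := linf_class (linf_max_Lfun u v).
Definition linf_meet (u v : Linfty) : Linfty := linf_class (linf_min_Lfun u v).
Definition linf_translate (t : R) (u : Linfty) : Linfty :=
  linf_class (linf_translate_Lfun t u).
Definition linf_cesaro (u : Linfty) : Linfty :=
  linf_class (linf_cesaro_Lfun u).

Definition valuation (mu : Linfty -> R) : Prop :=
  (forall u v, mu (linf_join u v) + mu (linf_meet u v) = mu u + mu v) /\
  mu linf_zero = 0.

Definition translation_invariant (mu : Linfty -> R) : Prop :=
  forall t u, mu (linf_translate t u) = mu u.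

Definition monotone_functional (mu : Linfty -> R) : Prop :=
  forall u v, (\forall x \ae leb, linf_fun u x <= linf_fun v x) ->
    mu u <= mu v.

Definition continuous_functional (mu : Linfty -> R) : Prop :=
  forall (u_ : nat -> Linfty) (u : Linfty),
    'N[leb]_+oo[EFin \o (linf_fun (u_ n) \- linf_fun u)%R]%E
      @[n --> \oo] --> 0%E ->
    mu (u_ n) @[n --> \oo] --> mu u.

Definition nontrivial_functional (mu : Linfty -> R) : Prop :=
  ~ (forall u, mu u = 0).

Lemma ultrafilterP (U : set_system R) :
  UltraFilter U <-> ProperFilter U /\ forall A, U A \/ U (~` A).
Proof.
split=> [UU|[PU UC]].
  by split=> [|A]; [exact: ultra_proper|exact: in_ultra_setVsetC].
split=> // G PG UG; apply/seteqP; split=> // A GA.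
have [//|/UG GnA] := UC A.
by have /filter_ex[x []] : G (A `&` ~` A) by exact: filterI.
Qed.

Definition lebesgue_ultrafilter (U : set_system R) : Prop :=
  UltraFilter U /\ forall N : set R, leb.-negligible N -> U (~` N).

Definition right_ultrafilter (U : set_system R) : Prop :=
  UltraFilter U /\ forall a : R, U [set` `]a, +oo[].

Definition left_ultrafilter (U : set_system R) : Prop :=
  UltraFilter U /\ forall a : R, U [set` `]-oo, a[].

(* [lim] is total; [ulimP] shows that for a Lebesgue-ultrafilter it is the unique
   l all of whose open intervals ]l - e, l + e[ have preimage in U. *)
Definition ulim (U : set_system R) (v : Linfty) : R :=
  lim (linf_fun v x @[x --> U]).

Lemma ulimP (U : set_system R) (v : Linfty) (l : R) : lebesgue_ultrafilter U ->
  (forall e, 0 < e -> U [set x | linf_fun v x \in `]l - e, l + e[]) <->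
  ulim U v = l.
Proof.
move=> [UU UN]; pose F := linf_fun v x @[x --> U].
have cvgE k : (forall e, 0 < e -> U [set x | linf_fun v x \in `]k - e, k + e[])
    <-> F --> k.
  have E e : [set x | linf_fun v x \in `]k - e, k + e[] =
      [set x | `|k - linf_fun v x| < e].
    by apply/seteqP; split=> x /=; rewrite in_itv/= -ltr_distlC.
  by split=> [H|/cvgrPdist_lt H e e0]; [apply/cvgrPdist_lt => e e0;
    have := H e e0; rewrite E|rewrite E; exact: H].
have PU : ProperFilter U by exact: ultra_proper.
have PF : ProperFilter F by exact: fmap_proper_filter.
rewrite cvgE; split=> [|<-]; first exact: (@cvg_lim R).
have [_ [M vM]] := (LfunyP _).1 (linf_funP v).
have FU : UltraFilter F.
  apply/ultrafilterP; split; first exact: PF.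
  by move=> A; exact: (@in_ultra_setVsetC _ U (linf_fun v @^-1` A)).
have FM : F [set` `[- M, M]].
  have := UN _ vM; rewrite setCK; apply: (@filterS _ U _ _ (linf_fun v @^-1` _)).
  by move=> x /=; rewrite in_itv/= ler_norml.
have [k [_ Fk]] : [set` `[- M, M]] `&` [set p | F --> p] !=set0.
  have := @segment_compact R (- M) M.
  by rewrite compact_ultra; exact.
by apply/cvg_ex; exists k.
Qed.

Definition Blim (U : set_system R) (u : Linfty) : R := ulim U (linf_cesaro u).
End Linfty.
Arguments Linfty : clear implicits.

(* Main.v *)
(* Away from 0, u |-> \hat u(x) is a positive linear functional that fixes
   constants, and these points form a set of U; linearity together with
   max(u,v) + min(u,v) = u + v gives the valuation property, and positivity
   gives monotonicity and the Lipschitz bound behind continuity.  A translation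
   by t changes the integral over [0,x] only through two end pieces of length
   |t|, hence \hat u(x) by at most 2 ||u|| |t| / |x|, which tends to 0 along a
   one-sided ultrafilter. *)
Require Import Defs.
From mathcomp Require Import all_boot all_order all_algebra.
From mathcomp Require Import all_classical all_reals all_analysis.
From mathcomp Require Import measurable_realfun ess_sup_inf.

Set Implicit Arguments.
Unset Strict Implicit.
Unset Printing Implicit Defensive.
Import Order.TTheory GRing.Theory Num.Theory.
Import numFieldNormedType.Exports.
(* The sequences library also exports a [cesaro]. *)
Import Defs.

Local Open Scope classical_set_scope.
Local Open Scope ring_scope.

(** * Integrals of essentially bounded functions over intervals *)

Section bounded_integrals.
Context {R : realType}.
Local Notation leb := (leb R).
Implicit Types (f g : R -> R).

Lemma Lfuny_bounded f : f \in Lfun leb +oo%E ->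
  exists2 M : R, 0 <= M & \forall x \ae leb, `|f x| <= M.
Proof.
move=> /LfunyP[_ [M fM]]; exists (Num.max 0 M); first by rewrite le_max lexx.
by apply: filterS fM => x fM; rewrite le_max fM orbT.
Qed.

Lemma Lfuny_integrable f (a b : R) (x y : bool) : f \in Lfun leb +oo%E ->
  leb.-integrable [set` Interval (BSide x a) (BSide y b)] (EFin \o f).
Proof.
move=> fP; have [M M0 fM] := Lfuny_bounded fP.
by have [mf _] := (LfunyP f).1 fP; exact: (bounded_integrable_itv mf M0 fM).
Qed.

Lemma ae_le_Rintegral_itv f g (a b : R) (x y : bool) :
  f \in Lfun leb +oo%E -> g \in Lfun leb +oo%E ->
  (\forall z \ae leb, f z <= g z) ->
  \int[leb]_(z in [set` Interval (BSide x a) (BSide y b)]) f z <=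
  \int[leb]_(z in [set` Interval (BSide x a) (BSide y b)]) g z.
Proof.
move=> fP gP fg; set D := [set` _].
have [mf _] := (LfunyP f).1 fP; have [mg _] := (LfunyP g).1 gP.
have mD : measurable (D : set (lebT R)) by exact: leb_measurable_itv.
(* Monotonicity of the integral is applied to a pointwise inequality, so [g] is replaced by [h],
   which dominates [f] everywhere and equals [g] almost everywhere. *)
pose h z := Num.max (f z) (g z).
have mh : measurable_fun [set: lebT R] h by exact: measurable_maxr.
have hg : \forall z \ae leb, h z = g z.
  by apply: filterS fg => z fgz; exact: max_r.
have hP : h \in Lfun leb +oo%E.
  apply/LfunyP; split => //; have [M _ gM] := Lfuny_bounded gP.
  by exists M; apply: filterS2 hg gM => z ->.
have -> : \int[leb]_(z in D) g z = \int[leb]_(z in D) h z.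
  congr fine; apply: ae_eq_integral => //.
  - exact/measurable_EFinP/(measurable_funS _ _ mg).
  - exact/measurable_EFinP/(measurable_funS _ _ mh).
  - by apply: filterS hg => z /= ->.
apply: le_Rintegral => //; try exact: Lfuny_integrable.
by move=> z _; rewrite le_max lexx.
Qed.

(** Change of variables: Lebesgue measure is its own pushforward under [z |-> z - t], since the
    outer measure is translation-invariant. *)
Lemma Rintegral_itv_shift f (t a b : R) : f \in Lfun leb +oo%E ->
  \int[leb]_(z in `[a, b]) f (z - t) = \int[leb]_(z in `[a - t, b - t]) f z.
Proof.
move=> fP; have [mf [M fM]] := (LfunyP f).1 fP.
pose phi : lebT R -> lebT R := fun z => z - t.
have mphi : measurable_fun setT phi.
  by move=> _ Y mY; rewrite setTI; exact: leb_measurable_shift.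
have pleb : pushforward leb phi = leb.
  by apply/funext => A; exact: mu_ext_shift.
have E : phi @^-1` [set` `[a - t, b - t]] = [set` `[a, b]].
  by apply/seteqP; split=> z; rewrite /= !in_itv/= !lerD2r.
have fsP : (f \o phi) \in Lfun leb +oo%E.
  apply/LfunyP; split; last by exists M; exact: (@ae_shift _ t _ fM).
  exact: measurableT_comp mf mphi.
have mI : measurable (`[a - t, b - t]%classic : set (lebT R)).
  exact: leb_measurable_itv.
have fsi : leb.-integrable (phi @^-1` `[a - t, b - t]%classic)
    ((EFin \o f) \o phi).
  by rewrite E; exact: (Lfuny_integrable _ _ _ _ fsP).
have := integral_pushforward mphi ((measurable_EFinP _ _).2 mf) fsi mI.
by rewrite pleb E /Rintegral => ->.
Qed.

(** For [0 <= t], both intervals sit inside [[a - t, b]]. Splitting that integral at [a] and at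
    [b - t] leaves as difference two end pieces of length [t], each contributing at most [M * t].
    The two intervals may be disjoint. *)
Lemma Rintegral_itv_slide f (M t a b : R) : f \in Lfun leb +oo%E -> 0 <= M ->
  (\forall x \ae leb, `|f x| <= M) -> a <= b ->
  `|\int[leb]_(z in `[a - t, b - t]) f z - \int[leb]_(z in `[a, b]) f z|
    <= 2 * M * `|t|.
Proof.
move=> fP M0 fM; have [mf _] := (LfunyP f).1 fP.
(* Sliding [[a - t, b - t]] by [- t] gives back [[a, b]], so a negative [t] only swaps the two
   integrals. *)
wlog t0 : t a b / 0 <= t.
  move=> H ab; have [/H|/ltW t0] := leP 0 t; first exact.
  have := H (- t) (a - t) (b - t).
  by rewrite oppr_ge0 normrN lerD2r !opprK !subrK distrC; exact.
move=> ab; rewrite (ger0_norm t0).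
have split1 : \int[leb]_(z in `[a - t, b]) f z =
    \int[leb]_(z in `[a - t, a[) f z + \int[leb]_(z in `[a, b]) f z.
  have D : [set` `[a - t, b]] = [set` `[a - t, a[] `|` [set` `[a, b]].
    by apply: itv_bndbnd_setU; rewrite bnd_simp// gerBl.
  rewrite D Rintegral_setU//.
  - exact: leb_measurable_itv.
  - exact: leb_measurable_itv.
  - by rewrite -D; exact: Lfuny_integrable.
  - apply/disj_setPS => z [/=]; rewrite 2!in_itv/= => /andP[_ zx] /andP[].
    by rewrite leNgt zx.
have split2 : \int[leb]_(z in `[a - t, b]) f z =
    \int[leb]_(z in `[a - t, b - t]) f z + \int[leb]_(z in `]b - t, b]) f z.
  have D : [set` `[a - t, b]] = [set` `[a - t, b - t]] `|` [set` `]b - t, b]].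
    by apply: itv_bndbnd_setU; rewrite bnd_simp// ?lerD2r// gerBl.
  rewrite D Rintegral_setU//.
  - exact: leb_measurable_itv.
  - exact: leb_measurable_itv.
  - by rewrite -D; exact: Lfuny_integrable.
  - apply/disj_setPS => z [/=]; rewrite 2!in_itv/= => /andP[_ zx] /andP[].
    by rewrite ltNge zx.
have at_ : a - t <= a by rewrite gerBl.
have bt : b - t <= b by rewrite gerBl.
have b1 := bounded_Rintegral_itv mf M0 fM true true at_.
have b2 := bounded_Rintegral_itv mf M0 fM false false bt.
have -> : \int[leb]_(z in `[a - t, b - t]) f z - \int[leb]_(z in `[a, b]) f z =
    \int[leb]_(z in `[a - t, a[) f z - \int[leb]_(z in `]b - t, b]) f z.
  by apply/eqP; rewrite subr_eq addrAC -split1 split2 addrK.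
apply: (le_trans (ler_normB _ _)); apply: (le_trans (lerD b1 b2)).
by rewrite !subKr -mulrA [leRHS]mulrDl mul1r.
Qed.
End bounded_integrals.

(** * Cesàro averages at a fixed nonzero point *)

Section cesaro_means.
Context {R : realType}.
Local Notation leb := (leb R).
Implicit Types (f g : R -> R).

(* Away from 0 the two orientations of [oint] are a single unoriented average. *)
Lemma cesaroE f (x : R) : x != 0 ->
  cesaro f x = `|x|^-1 * \int[leb]_(y in `[Num.min 0 x, Num.max 0 x]) f y.
Proof.
rewrite /cesaro /oint => x0; rewrite (negbTE x0).
have [x_ge0|x_lt0] := leP 0 x; first by rewrite ger0_norm.
by rewrite ltr0_norm// invrN mulrN mulNr.
Qed.

Lemma cesaro_ler f g (x : R) : f \in Lfun leb +oo%E -> g \in Lfun leb +oo%E ->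
  x != 0 -> (\forall y \ae leb, f y <= g y) -> cesaro f x <= cesaro g x.
Proof.
move=> fP gP x0 fg; rewrite !cesaroE// ler_wpM2l ?invr_ge0//.
exact: ae_le_Rintegral_itv.
Qed.

(** This makes the average independent of the representative. It needs [x != 0], because at 0 the
    average is the value [f 0] itself. *)
Lemma eq_cesaro f g (x : R) : f \in Lfun leb +oo%E -> g \in Lfun leb +oo%E ->
  x != 0 -> (\forall y \ae leb, f y = g y) -> cesaro f x = cesaro g x.
Proof.
move=> fP gP x0 fg; apply/eqP; rewrite eq_le; apply/andP; split.
  by apply: cesaro_ler => //; apply: filterS fg => y ->.
by apply: cesaro_ler => //; apply: filterS fg => y ->.
Qed.

Lemma cesaroD f g (x : R) : f \in Lfun leb +oo%E -> g \in Lfun leb +oo%E ->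
  x != 0 -> cesaro (fun y => f y + g y) x = cesaro f x + cesaro g x.
Proof.
move=> fP gP x0; rewrite !cesaroE// -mulrDr RintegralD//.
- exact: leb_measurable_itv.
- exact: Lfuny_integrable.
- exact: Lfuny_integrable.
Qed.

Lemma cesaro_cst (c x : R) : x != 0 -> cesaro (cst c) x = c.
Proof.
move=> x0; rewrite cesaroE// Rintegral_cst; last exact: leb_measurable_itv.
rewrite [X in fine X](_ : _ = `|x|%:E).
  by rewrite mulrCA mulVf ?mulr1// normr_eq0.
rewrite [LHS](leb_itv `[Num.min 0 x, Num.max 0 x])/= lte_fin -EFinB.
have [x_ge0|x_lt0] := leP 0 x; last by rewrite x_lt0 sub0r ltr0_norm.
by rewrite lt_neqAle eq_sym x0 x_ge0 subr0 ger0_norm.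
Qed.

Lemma Lfuny_addr f g : f \in Lfun leb +oo%E -> g \in Lfun leb +oo%E ->
  (fun y => f y + g y) \in Lfun leb +oo%E.
Proof.
move=> fP gP; have [mf [M fM]] := (LfunyP f).1 fP.
have [mg [N gN]] := (LfunyP g).1 gP.
apply/LfunyP; split; first exact: measurable_funD.
exists (M + N); apply: filterS2 fM gN => y fM gN.
by rewrite (le_trans (ler_normD _ _))// lerD.
Qed.

Lemma cesaro_dist f g (K x : R) : f \in Lfun leb +oo%E ->
  g \in Lfun leb +oo%E -> x != 0 -> (\forall y \ae leb, `|f y - g y| <= K) ->
  `|cesaro f x - cesaro g x| <= K.
Proof.
move=> fP gP x0 fgK.
have le h k : h \in Lfun leb +oo%E -> k \in Lfun leb +oo%E ->
    (\forall y \ae leb, `|h y - k y| <= K) -> cesaro h x <= K + cesaro k x.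
  move=> hP kP hkK; have KP := linf_cst_Lfun K.
  (* Reading [K] as the average of a constant turns the bound into positivity applied to
     [h <= K + k]. *)
  rewrite -[X in X + _](cesaro_cst K x0) -cesaroD//.
  apply: cesaro_ler => //; first exact: Lfuny_addr.
  by apply: filterS hkK => y /(le_trans (ler_norm _)); rewrite lerBlDr.
rewrite ler_norml lerBlDr le// lerNl opprB lerBlDr le//.
by apply: filterS fgK => y; rewrite distrC.
Qed.

Lemma cesaro_shift_dist f (M t x : R) : f \in Lfun leb +oo%E -> 0 <= M ->
  (\forall y \ae leb, `|f y| <= M) -> x != 0 ->
  `|cesaro (fun y => f (y - t)) x - cesaro f x| <= 2 * M * `|t| / `|x|.
Proof.
move=> fP M0 fM x0; rewrite !cesaroE// -mulrBr normrM normfV normr_id mulrC.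
rewrite ler_wpM2r ?invr_ge0// Rintegral_itv_shift//.
by apply: Rintegral_itv_slide => //; rewrite ge_min !le_max lexx.
Qed.
End cesaro_means.

(** * Passage to the limit along the ultrafilter *)

Section Blim_facts.
Context {R : realType} (U : set_system R).
Hypothesis UL : lebesgue_ultrafilter U.
Hypothesis Uside : right_ultrafilter U \/ left_ultrafilter U.
Local Notation leb := (leb R).

#[local] Instance Uproper : ProperFilter U.
Proof. by have [UU _] := UL; exact: ultra_proper. Qed.

(** [Blim] is defined through a chosen representative of the class of the average. That
    representative differs from the pointwise average only on a null set, whose complement lies in
    [U], so later arguments can use the explicit formula. *)
Lemma Blim_cvg (u : Linfty R) : cesaro (linf_fun u) x @[x --> U] --> Blim U u.
Proof.
apply/cvgrPdist_lt => e e0.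
have /(_ e e0) := (ulimP (linf_cesaro u) (Blim U u) UL).2 erefl.
have := UL.2 _ (linf_classE (linf_cesaro_Lfun u)).
rewrite setCK; apply: filterS2 => x /= ->.
by rewrite in_itv/= -ltr_distlC.
Qed.

(** Sidedness enters only through this divergence of [|x|], which treats right and left ultrafilters
    alike. *)
Lemma near_side_norm (A : R) : \forall x \near U, A < `|x|.
Proof.
case: Uside => -[_ H]; first have := H A; last have := H (- A).
  apply: filterS => x /=; rewrite in_itv/= andbT => /lt_le_trans; apply.
  exact: ler_norm.
apply: filterS => x /=; rewrite in_itv/= ltrNr => /lt_le_trans; apply.
by rewrite -normrN ler_norm.
Qed.

Lemma near_side_neq0 : \forall x \near U, x != 0.
Proof. by apply: filterS (near_side_norm 0) => x; rewrite normr_gt0. Qed.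

Lemma Blim_dist (u v : Linfty R) (K : R) :
  (\forall x \near U, `|cesaro (linf_fun u) x - cesaro (linf_fun v) x| <= K) ->
  `|Blim U u - Blim U v| <= K.
Proof.
move=> uvK; have uv := cvg_norm (cvgB (@Blim_cvg u) (@Blim_cvg v)).
apply: (cvgr_to_le (F := U)); [exact: uv|exact: uvK].
Qed.

(** The case [c = 0] normalises the valuation and [c = 1] shows it non-trivial. *)
Lemma Blim_class_cst (c : R) : Blim U (linf_class (linf_cst_Lfun c)) = c.
Proof.
apply/eqP; rewrite -subr_eq0 -normr_le0.
have cc : (fun=> c) x @[x --> U] --> c by exact: cvg_cst.
have Bc := cvg_norm (cvgB (@Blim_cvg (linf_class (linf_cst_Lfun c))) cc).
apply: (cvgr_to_le (F := U)); first exact: Bc.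
apply: filterS near_side_neq0 => x x0 /=.
rewrite normr_le0 subr_eq0 -[X in _ == X](cesaro_cst c x0).
apply/eqP; apply: eq_cesaro => //.
- exact: linf_funP.
- exact: linf_cst_Lfun.
- exact: linf_classE.
Qed.

Lemma Blim_valuation : valuation (Blim U).
Proof.
split=> [u v|].
  have J := cvgD (@Blim_cvg (linf_join u v)) (@Blim_cvg (linf_meet u v)).
  have S := cvgD (@Blim_cvg u) (@Blim_cvg v).
  rewrite -(cvg_lim (@Rhausdorff R) (J _)).
  apply/(cvg_lim (@Rhausdorff R))/(cvg_trans _ (S _))/near_eq_cvg.
  apply: filterS near_side_neq0 => x x0 /=.
  rewrite !fctE -!cesaroD ?linf_funP//; apply: eq_cesaro => //.
  - by apply: Lfuny_addr; exact: linf_funP.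
  - by apply: Lfuny_addr; exact: linf_funP.
  - apply: filterS2 (linf_classE (linf_max_Lfun u v))
      (linf_classE (linf_min_Lfun u v)) => y -> ->.
    by rewrite addr_max_min.
exact: Blim_class_cst.
Qed.

Lemma Blim_nontrivial : nontrivial_functional (Blim U).
Proof.
move=> /(_ (linf_class (linf_cst_Lfun 1))) B0.
by move: B0; rewrite Blim_class_cst => /eqP; rewrite oner_eq0.
Qed.

Lemma Blim_monotone : monotone_functional (Blim U).
Proof.
move=> u v uv; apply: ler_cvg_to (@Blim_cvg u) (@Blim_cvg v) _.
apply: filterS near_side_neq0 => x x0.
by apply: cesaro_ler => //; exact: linf_funP.
Qed.

Lemma Blim_continuous : continuous_functional (Blim U).
Proof.
move=> u_ u uu; apply/cvgrPdist_le => e e0.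
(* The norm is extended-real valued; convergence to 0 makes it eventually finite, hence comparable
   with [e]. *)
move/fine_cvgP : uu => [Nfin /cvgrPdist_le/(_ _ e0)].
apply: filterS2 Nfin => n Nn; rewrite sub0r normrN => /(le_trans (ler_norm _)).
rewrite -lee_fin fineK// unlock/= => Ne.
rewrite distrC; apply: Blim_dist.
apply: filterS near_side_neq0 => x x0.
apply: cesaro_dist => //; try exact: linf_funP.
(* The sup norm is an essential supremum only if the whole space has positive measure; otherwise
   every property holds almost everywhere. *)
move: Ne; case: ifPn => [_ /ess_supP|].
  by apply: filterS => y /=; rewrite lee_fin.
by rewrite -leNgt measure_le0 => /eqP mu0 _; exact: measure0_ae.
Qed.

Lemma Blim_translation : translation_invariant (Blim U).
Proof.
move=> t u; apply/eqP; rewrite -subr_eq0 -normr_le0; apply/ler_addgt0Pl => e e0.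
rewrite addr0; apply: Blim_dist.
have uP := linf_funP u; have [M M0 uM] := Lfuny_bounded uP.
(* Beyond this threshold the end-piece bound [2 * M * |t| / |x|] is below [e]. *)
apply: filterS2 near_side_neq0 (near_side_norm (2 * M * `|t| / e)) => x x0 xe.
rewrite (eq_cesaro (linf_funP _) (linf_translate_Lfun t u) x0 (linf_classE _)).
apply: le_trans (cesaro_shift_dist _ uP M0 uM x0) _.
by rewrite ler_pdivrMr ?normr_gt0// [leRHS]mulrC -ler_pdivrMr// ltW.
Qed.
End Blim_facts.

Theorem proposition8p1 (R : realType) (U : set_system R)
    (U_lebesgue : lebesgue_ultrafilter U)
    (U_side : right_ultrafilter U \/ left_ultrafilter U) :
  [/\ valuation (Blim U),
      nontrivial_functional (Blim U),
      monotone_functional (Blim U),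
      continuous_functional (Blim U) &
      translation_invariant (Blim U)].
Proof.
split; [exact: Blim_valuation|exact: Blim_nontrivial|exact: Blim_monotone|
  exact: Blim_continuous|exact: Blim_translation].
Qed.
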